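(* The basis function $\varphi$ belongs to $\mathcal N_2^{15}$ (with input dimension $2$); more precisely, for all $(x,y)\in\mathbb R^2$, $$\varphi(x,y)=\frac12\left(g_2\left(\frac{\mathrm{ReLU1}(x)}{2}\right)+g_2\left(\frac{\mathrm{ReLU1}(y)}{2}\right)-g_2\left(\frac{\mathrm{ReLU1}(x)+\mathrm{ReLU1}(y)}{2}\right)\right).$$
   Context: Let $\sigma(t)=\mathrm{ReLU}(t)=\max\{0,t\}$, applied componentwise to vectors, and $\mathrm{ReLU1}(t)=\mathrm{ReLU}(t)-\mathrm{ReLU}(t-1)$. For positive integers $d,L,N$, the class $\mathcal N_L^N$ (with input dimension $d$) is the set of functions $f=\theta^{L+1}\circ\sigma\circ\theta^L\circ\sigma\circ\cdots\circ\sigma\circ\theta^1:\mathbb R^d\to\mathbb R$ with arbitrary affine maps $\theta^1:\mathbb R^d\to\mathbb R^N$, $\theta^\ell:\mathbb R^N\to\mathbb R^N$ ($2\le\ell\le L$), $\theta^{L+1}:\mathbb R^N\to\mathbb R$. Let $g(x)=2x$ on $[0,\tfrac12]$, $g(x)=2(1-x)$ on $(\tfrac12,1]$, $g(x)=0$ otherwise, and $g_2=g\circ g$. Basis function $\varphi$. Let $m(x,y)=xy$ and $h_\ell=2^{-\ell}$. For $\ell\ge0$ set $x_{\ell,i}=(i-2^\ell)h_\ell$, $y_{\ell,j}=(j-2^\ell)h_\ell$, $i,j=0,\dots,2^{\ell+1}$. For $i,j\ne 2^{\ell+1}$ let $T^+_{\ell;i,j}=\{(x,y)\in[x_{\ell,i},x_{\ell,i}+h_\ell]\times[y_{\ell,j},y_{\ell,j}+h_\ell]: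 x+y\le x_{\ell,i}+y_{\ell,j}+h_\ell\}$, and for $i,j\neq0$ let $T^-_{\ell;i,j}=\{(x,y)\in[x_{\ell,i}-h_\ell,x_{\ell,i}]\times[y_{\ell,j}-h_\ell,y_{\ell,j}]: x+y\ge x_{\ell,i}+y_{\ell,j}-h_\ell\}$. These triangles form a uniform triangulation of $[-1,1]^2$, and $\Pi_\ell m$ is the continuous piecewise linear interpolant of $m$ at its vertices: $\Pi_\ell m(x,y)=x\,y_{\ell,j}+y\,x_{\ell,i}-x_{\ell,i}y_{\ell,j}$ on $T^+_{\ell;i,j}$ and on $T^-_{\ell;i,j}$. Then $\varphi:\mathbb R^2\to\mathbb R$ is defined by $\varphi(x,y)=4(\Pi_1m-\Pi_0m)(x,y)$ for $(x,y)\in[0,1]^2$ and $\varphi(x,y)=0$ otherwise; it is the linear finite element nodal basis function at $(\tfrac12,\tfrac12)$ on the uniform mesh of $[0,1]^2$ with mesh size $\tfrac12$. *)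

(* Defs.v *)
From HB Require Import structures.
From mathcomp Require Import all_boot all_order all_algebra.
From mathcomp Require Import classical_sets reals.
From mathcomp Require Import zify ring lra.

Set Implicit Arguments.
Unset Strict Implicit.
Unset Printing Implicit Defensive.

Import Order.TTheory GRing.Theory Num.Theory.

Local Open Scope ring_scope.

Section Networks.
Variable R : realType.

Definition relu (t : R) : R := Num.max 0 t.

Definition relu1 (t : R) : R := relu t - relu (t - 1).

Definition affine (m n : nat) (theta : 'M[R]_(n, m) * 'cV[R]_n)
    (x : 'cV[R]_m) : 'cV[R]_n :=
  theta.1 *m x + theta.2.

(* [mid] lists theta^2, ..., theta^L in order, so that the network has
   L = (size mid).+1 hidden layers. *)
Definition network (d N : nat) (first : 'M[R]_(N, d) * 'cV[R]_N)
    (mid : seq ('M[R]_(N, N) * 'cV[R]_N)) (last : 'M[R]_(1, N) * 'cV[R]_1)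
    (x : 'cV[R]_d) : R :=
  affine last (map_mx relu
    (foldl (fun z theta => affine theta (map_mx relu z)) (affine first x) mid))
    0 0.

Definition NN (d L N : nat) : set ('cV[R]_d -> R) :=
  [set f | exists first mid last,
     (size mid).+1 = L /\ forall x, f x = @network d N first mid last x]%classic.

End Networks.

Section BasisFunction.
Variable R : realType.

Definition g (x : R) : R :=
  if (0 <= x) && (x <= 2^-1) then 2 * x
  else if (2^-1 < x) && (x <= 1) then 2 * (1 - x)
  else 0.

Definition g2 (x : R) : R := g (g x).

Definition mesh_size (l : nat) : R := 2 ^- l.

(* The grid is the same in both directions: x_{l,i} = y_{l,i} = node l i. *)
Definition node (l i : nat) : R := (i%:R - 2 ^+ l) * mesh_size l.

Definition in_Tplus (l i j : nat) (x y : R) : bool :=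
  [&& node l i <= x <= node l i + mesh_size l,
      node l j <= y <= node l j + mesh_size l
    & x + y <= node l i + node l j + mesh_size l].

Definition in_Tminus (l i j : nat) (x y : R) : bool :=
  [&& node l i - mesh_size l <= x <= node l i,
      node l j - mesh_size l <= y <= node l j
    & node l i + node l j - mesh_size l <= x + y].

(* T^+ exists only for i, j <> 2^(l+1), and T^- only for i, j <> 0. *)
Definition in_triangle (l i j : nat) (x y : R) : bool :=
  [&& i != (2 ^ l.+1)%N, j != (2 ^ l.+1)%N & in_Tplus l i j x y]
  || [&& i != 0%N, j != 0%N & in_Tminus l i j x y].

Definition local_interp (l i j : nat) (x y : R) : R :=
  x * node l j + y * node l i - node l i * node l j.

(* Pi_l m for m(x, y) = x y.  The value does not depend on the triangle picked
   (lemma [interpE]); the value 0 is used only outside [-1, 1]^2. *)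
Definition interp (l : nat) (x y : R) : R :=
  if [pick p : 'I_(2 ^ l.+1).+1 * 'I_(2 ^ l.+1).+1 | in_triangle l p.1 p.2 x y]
    is Some p then local_interp l p.1 p.2 x y
  else 0.

Definition phi (x y : R) : R :=
  if [&& 0 <= x, x <= 1, 0 <= y & y <= 1]
  then 4 * (interp 1 x y - interp 0 x y) else 0.

Lemma mesh_size_gt0 (l : nat) : 0 < mesh_size l.
Proof. by rewrite invr_gt0 exprn_gt0 // ltr0n. Qed.

Lemma node_diff (l i i' : nat) :
  node l i' = node l i + (i'%:Z - i%:Z)%:~R * mesh_size l.
Proof. by rewrite /node rmorphB /= -!pmulrn; ring. Qed.

Lemma small_step (h u u' : R) (z : int) : 0 < h -> u' = u - z%:~R * h ->
  - h <= u <= h -> - h <= u' <= h ->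
  exists2 k : R, z%:~R = k & k \in [:: -2; -1; 0; 1; 2].
Proof.
move=> h0 e hu hu'.
have [l1 l2] : (-2)%:~R <= z%:~R :> R /\ z%:~R <= 2%:~R :> R.
  by split; rewrite -(ler_pM2r h0); lra.
rewrite !ler_int in l1 l2.
have : z \in ([:: -2; -1; 0; 1; 2] : seq int) by rewrite !inE; lia.
rewrite !inE => /orP[|/or4P[]] /eqP ->.
- by exists (-2); rewrite ?inE ?eqxx ?orbT.
- by exists (-1); rewrite ?inE ?eqxx ?orbT.
- by exists 0; rewrite ?inE ?eqxx ?orbT.
- by exists 1; rewrite ?inE ?eqxx ?orbT.
- by exists 2; rewrite ?inE ?eqxx ?orbT.
Qed.

(* (u, v) and (u', v') are the offsets of one point from the base vertices of
   two triangles; both local interpolants are x y minus the product of the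
   offsets. *)
Lemma offset_mul_eq (h u v u' v' : R) (a b : int) : 0 < h ->
  u' = u - a%:~R * h -> v' = v - b%:~R * h ->
  [/\ 0 <= u, 0 <= v & u + v <= h] \/ [/\ u <= 0, v <= 0 & - h <= u + v] ->
  [/\ 0 <= u', 0 <= v' & u' + v' <= h] \/
    [/\ u' <= 0, v' <= 0 & - h <= u' + v'] ->
  u * v = u' * v'.
Proof.
move=> h0 ea eb A B.
have [p pE hp] : exists2 k : R, a%:~R = k & k \in [:: -2; -1; 0; 1; 2].
  by apply: (small_step h0 ea); [case: A | case: B] => -[]; lra.
have [q qE hq] : exists2 k : R, b%:~R = k & k \in [:: -2; -1; 0; 1; 2].
  by apply: (small_step h0 eb); [case: A | case: B] => -[]; lra.
rewrite {}pE in ea; rewrite {}qE in eb; clear a b.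
have mul_eq0 (s t : R) : s = 0 \/ t = 0 -> s * t = 0.
  by case=> ->; rewrite ?mul0r ?mulr0.
move: hp hq; rewrite !inE.
move=> /orP[|/or4P[]] /eqP ep /orP[|/or4P[]] /eqP eq_q; subst p q u' v';
  case: A => -[? ? ?]; case: B => -[? ? ?];
  first [ exfalso; lra
        | ring
        | (have v_u : v = h - u by lra); rewrite v_u; ring
        | (have v_u : v = - h - u by lra); rewrite v_u; ring
        | transitivity (0 : R); [|symmetry];
            (apply: mul_eq0; first [left; lra | right; lra]) ].
Qed.

Lemma local_interp_eq (l i j i' j' : nat) (x y : R) :
  in_triangle l i j x y -> in_triangle l i' j' x y ->
  local_interp l i j x y = local_interp l i' j' x y.
Proof.
have fE k k' : local_interp l k k' x y =
    x * y - (x - node l k) * (y - node l k') by rewrite /local_interp; ring.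
have T k k' : in_triangle l k k' x y ->
    let u := x - node l k in let v := y - node l k' in let h := mesh_size l in
    [/\ 0 <= u, 0 <= v & u + v <= h] \/ [/\ u <= 0, v <= 0 & - h <= u + v].
  case/orP => /and3P[_ _ /and3P[/andP[a b] /andP[c d] e]]; [left|right];
    by split; lra.
move=> /T A /T B; rewrite !fE; congr (_ - _).
apply: (offset_mul_eq (mesh_size_gt0 l) _ _ A B).
- by rewrite (node_diff l i i') opprD addrA.
- by rewrite (node_diff l j j') opprD addrA.
Qed.

Lemma interpE (l i j : nat) (x y : R) :
  (i <= 2 ^ l.+1)%N -> (j <= 2 ^ l.+1)%N -> in_triangle l i j x y ->
  interp l x y = local_interp l i j x y.
Proof.
rewrite -[(i <= _)%N]ltnS -[(j <= _)%N]ltnS => Hi Hj T; rewrite /interp.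
case: pickP => [[a b] /= Tab|/(_ (Ordinal Hi, Ordinal Hj))]; last by rewrite /= T.
exact: local_interp_eq.
Qed.

Lemma interp_node (l i j : nat) :
  (i <= 2 ^ l.+1)%N -> (j <= 2 ^ l.+1)%N ->
  interp l (node l i) (node l j) = node l i * node l j.
Proof.
move=> hi hj; have h0 := mesh_size_gt0 l.
have pos : (0 < 2 ^ l.+1)%N by rewrite expn_gt0.
have S k : node l k.+1 = node l k + mesh_size l.
  by rewrite (node_diff l k) intS addrK mul1r.
have E i' j' : (i' <= 2 ^ l.+1)%N -> (j' <= 2 ^ l.+1)%N ->
    in_triangle l i' j' (node l i) (node l j) ->
    (node l i - node l i') * (node l j - node l j') = 0 ->
    interp l (node l i) (node l j) = node l i * node l j.
  move=> hi' hj' T e; rewrite (interpE hi' hj' T) /local_interp.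
  by rewrite -[RHS]subr0 -e; ring.
case: i hi S E => [|i] hi S E; case: j hj E => [|j] hj E.
- apply: (E 0%N 0%N hi hj); last by rewrite subrr mul0r.
  rewrite /in_triangle /in_Tplus neq_ltn pos /=; apply/orP; left.
  by apply/and3P; split; lra.
- apply: (E 1%N j.+1 pos hj); last by rewrite subrr mulr0.
  rewrite /in_triangle /in_Tminus (S 0%N) /=; apply/orP; right.
  by apply/and3P; split; lra.
- apply: (E i.+1 1%N hi pos); last by rewrite subrr mul0r.
  rewrite /in_triangle /in_Tminus (S 0%N) /=; apply/orP; right.
  by apply/and3P; split; lra.
- apply: (E i.+1 j.+1 hi hj); last by rewrite subrr mul0r.
  rewrite /in_triangle /in_Tminus /=; apply/orP; right.
  by apply/and3P; split; lra.
Qed.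

End BasisFunction.

(* Main.v *)
Require Import Defs.
From mathcomp Require Import all_boot all_order all_algebra.
From mathcomp Require Import reals.
From mathcomp Require Import ring lra.

Set Implicit Arguments.
Unset Strict Implicit.

(** Both sides are continuous and piecewise linear, so the work is to write each
    of them explicitly with [relu].

    Put [X = relu1 x] and [Y = relu1 y], the clampings of [x] and [y] to
    [[0, 1]].  On [[0, 1]] the function [s |-> g2 (s / 2)] is one sawtooth of
    period 1 and height 1, and on [[0, 2]] it is two of them
    ([g2_half_relu]).  If [x] or [y] lies outside [[0, 1]], then [X] or [Y] is
    0 or 1, and by periodicity the three sawtooth terms cancel, as they must
    since [phi] vanishes there.  Inside the unit square, [phi] is computed cell
    by cell ([interp_cell]): the interpolant of [x y] on a cell of the mesh is
    affine up to a single kink across the antidiagonal of that cell.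

    The formula then gives a network with two hidden layers.  The sawtooth
    [g2 (X / 2)] has its kinks at 0, 1/2 and 1, so it is a combination of
    [relu x], [relu (x - 1/2)] and [relu (x - 1)], and likewise for [y].  The
    number [S = X + Y] is also linear in these six outputs, and
    [g2 (S / 2)] is a combination of [S], [relu (S - 1/2)], [relu (S - 1)] and
    [relu (S - 3/2)].  The second layer also has to carry [S] and
    [g2 (X / 2) + g2 (Y / 2)]; both are nonnegative, so [relu] leaves them
    unchanged.  Six neurons per layer are thus enough, and neurons that always
    output 0 may be added to reach width 15 ([NN_widen]). *)

Import Order.TTheory GRing.Theory Num.Theory.
Local Open Scope ring_scope.

(** * Enlarging the width of a network *)

Section Widening.
Variables (R : realType) (N k : nat).

Definition pad_first (d : nat) (theta : 'M[R]_(N, d) * 'cV[R]_N) :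
    'M[R]_(N + k, d) * 'cV[R]_(N + k) :=
  (col_mx theta.1 0, col_mx theta.2 0).

Definition pad_mid (theta : 'M[R]_(N, N) * 'cV[R]_N) :
    'M[R]_(N + k, N + k) * 'cV[R]_(N + k) :=
  (block_mx theta.1 0 0 0, col_mx theta.2 0).

Definition pad_last (theta : 'M[R]_(1, N) * 'cV[R]_1) :
    'M[R]_(1, N + k) * 'cV[R]_1 :=
  (row_mx theta.1 0, theta.2).

Lemma map_relu_pad (z : 'cV[R]_N) :
  map_mx (@relu R) (col_mx z (0 : 'cV_k)) = col_mx (map_mx (@relu R) z) 0.
Proof.
rewrite map_col_mx; congr col_mx.
by apply/matrixP => i j; rewrite !mxE /relu maxxx.
Qed.

Lemma affine_pad_first d theta (x : 'cV[R]_d) :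
  affine (pad_first theta) x = col_mx (affine theta x) 0.
Proof. by rewrite /affine /= mul_col_mx mul0mx add_col_mx addr0. Qed.

Lemma affine_pad_mid theta (z : 'cV[R]_N) :
  affine (pad_mid theta) (col_mx z 0) = col_mx (affine theta z) 0.
Proof.
by rewrite /affine /= mul_block_col !mul0mx !addr0 add_col_mx addr0.
Qed.

Lemma affine_pad_last theta (z : 'cV[R]_N) :
  affine (pad_last theta) (col_mx z 0) = affine theta z.
Proof. by rewrite /affine /= mul_row_col mul0mx addr0. Qed.

(** The invariant is that the added neurons hold 0 before each activation; they
    keep it because [relu 0 = 0] and their weights and biases are 0. *)
Lemma network_pad d first mid last (x : 'cV[R]_d) :
  network (pad_first first) (map pad_mid mid) (pad_last last) x =
  network first mid last x.
Proof.
rewrite /network affine_pad_first.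
set z := affine first x; move: z => z.
suff -> : foldl (fun z theta => affine theta (map_mx (@relu R) z)) (col_mx z 0)
    (map pad_mid mid) = col_mx (foldl (fun z theta =>
      affine theta (map_mx (@relu R) z)) z mid) 0.
  by rewrite map_relu_pad affine_pad_last.
elim: mid z => //= theta mid IH z.
by rewrite map_relu_pad affine_pad_mid IH.
Qed.

End Widening.

Lemma NN_widen (R : realType) (d L N N' : nat) (f : 'cV[R]_d -> R) :
  (N <= N')%N -> @NN R d L N f -> @NN R d L N' f.
Proof.
move=> /subnKC <- [first [mid [last [sz fE]]]].
exists (pad_first _ first), (map (pad_mid _) mid), (pad_last _ last).
by split=> [|x]; rewrite ?size_map // network_pad.
Qed.

(** * The sawtooth and the basis function in terms of relu *)

Lemma relu_ge0 (R : realType) (t : R) : 0 <= t -> relu t = t.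
Proof. exact: max_r. Qed.

Lemma relu_le0 (R : realType) (t : R) : t <= 0 -> relu t = 0.
Proof. exact: max_l. Qed.

(* On a region bounded by the kinks every relu is its argument or 0, and what
   remains is a linear goal. *)
Ltac relu_signs := repeat match goal with |- context [relu ?t] =>
  first [ rewrite (@relu_ge0 _ t); last lra
        | rewrite (@relu_le0 _ t); last lra ] end.

Section BasisFunctionRelu.
Variable R : realType.
Implicit Types s t x y : R.

Lemma g_relu t : g t = 2 * relu t - 4 * relu (t - 2^-1) + 2 * relu (t - 1).
Proof.
rewrite /g; case: (leP 0 t) => ?; case: (leP t 2^-1) => ? /=;
  case: (leP t 1) => ? /=; relu_signs; lra.
Qed.

Lemma g2_half_relu s : 0 <= s <= 2 ->
  g2 (s / 2) =
  2 * s - 4 * relu (s - 1 / 2) + 4 * relu (s - 1) - 4 * relu (s - 3 / 2).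
Proof.
move=> /andP[? ?]; rewrite /g2.
case: (leP s 1) => ?.
- have -> : g (s / 2) = s by rewrite g_relu; relu_signs; lra.
  by rewrite g_relu; case: (leP s (1 / 2)) => ?; relu_signs; lra.
- have -> : g (s / 2) = 2 - s by rewrite g_relu; relu_signs; lra.
  by rewrite g_relu; case: (leP s (3 / 2)) => ?; relu_signs; lra.
Qed.

Lemma relu1_le0 x : x <= 0 -> relu1 x = 0.
Proof. by move=> ?; rewrite /relu1; relu_signs; lra. Qed.

Lemma relu1_id x : 0 <= x <= 1 -> relu1 x = x.
Proof. by move=> /andP[? ?]; rewrite /relu1; relu_signs; lra. Qed.

Lemma relu1_ge1 x : 1 <= x -> relu1 x = 1.
Proof. by move=> ?; rewrite /relu1; relu_signs; lra. Qed.

Lemma relu1_itv x : 0 <= relu1 x <= 1.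
Proof.
case: (leP x 0) => [/relu1_le0 ->|x0]; first by rewrite lexx ler01.
case: (leP 1 x) => [/relu1_ge1 ->|x1]; first by rewrite lexx ler01.
by rewrite relu1_id ltW // ltW.
Qed.

Lemma g2_relu1 x :
  g2 (relu1 x / 2) = 2 * relu x - 4 * relu (x - 1 / 2) + 2 * relu (x - 1).
Proof.
have /andP[? ?] := relu1_itv x.
rewrite g2_half_relu; last by apply/andP; split; lra.
case: (leP x 0) => [x0|x0]; first by rewrite relu1_le0 //; relu_signs; lra.
case: (leP 1 x) => [x1|x1]; first by rewrite relu1_ge1 //; relu_signs; lra.
rewrite relu1_id; last by rewrite !ltW.
by case: (leP x (1 / 2)) => ?; relu_signs; lra.
Qed.

(** At [s = 1] a whole period of the sawtooth has been run through. *)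
Lemma g2_terms_cancel s t : s = 0 \/ s = 1 -> 0 <= t <= 1 ->
  g2 (s / 2) + g2 (t / 2) - g2 ((s + t) / 2) = 0.
Proof.
move=> s01 /andP[? ?].
rewrite !g2_half_relu; try by apply/andP; split; case: s01; lra.
by case: s01 => ->; case: (leP t (1 / 2)) => ?; relu_signs; lra.
Qed.

(** On [T^+] the interpolant is the affine function [local_interp l i j], and
    passing the antidiagonal of the cell into [T^-] adds the last term: with
    [u], [v] the offsets from the lower left corner, the two affine functions
    are [x y - u v] and [x y - (h - u) (h - v)], whose difference is
    [h (u + v - h)]. *)
Lemma interp_cell (l i j : nat) x y :
  (i < 2 ^ l.+1)%N -> (j < 2 ^ l.+1)%N ->
  node R l i <= x <= node R l i + mesh_size R l ->
  node R l j <= y <= node R l j + mesh_size R l ->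
  interp l x y = local_interp l i j x y +
    mesh_size R l * relu (x + y - node R l i - node R l j - mesh_size R l).
Proof.
move=> hi hj /andP[x1 x2] /andP[y1 y2].
have S k : node R l k.+1 = node R l k + mesh_size R l.
  by rewrite (node_diff R l k) intS addrK mul1r.
case: (leP 0 (x + y - node R l i - node R l j - mesh_size R l)) => [H|/ltW H].
- rewrite relu_ge0 // (@interpE R l i.+1 j.+1) //; last first.
    rewrite /in_triangle /in_Tminus /= !S; apply/orP; right.
    by apply/and3P; split; lra.
  by rewrite /local_interp !S; ring.
- rewrite relu_le0 // (@interpE R l i j) ?mulr0 ?addr0 //; try exact: ltnW.
  rewrite /in_triangle /in_Tplus !neq_ltn hi hj /=; apply/orP; left.
  by apply/and3P; split; lra.
Qed.

Lemma phi_g2 x y :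
  phi x y = 1 / 2 * (g2 (relu1 x / 2) + g2 (relu1 y / 2)
                     - g2 ((relu1 x + relu1 y) / 2)).
Proof.
rewrite /phi; case: ifP => [/and4P[x0 x1 y0 y1]|out]; last first.
  have edge (z : R) : ~~ ((0 <= z) && (z <= 1)) -> relu1 z = 0 \/ relu1 z = 1.
    rewrite negb_and -!ltNge => /orP[] /ltW ?.
      by left; exact: relu1_le0.
    by right; exact: relu1_ge1.
  have /orP[/edge X01|/edge Y01] :
      ~~ ((0 <= x) && (x <= 1)) || ~~ ((0 <= y) && (y <= 1)).
    by rewrite -negb_and -andbA out.
  - by rewrite g2_terms_cancel ?relu1_itv ?mulr0.
  - by rewrite [relu1 x + _]addrC [g2 _ + g2 _]addrC
      g2_terms_cancel ?relu1_itv ?mulr0.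
rewrite !relu1_id ?x0 ?y0 // !g2_half_relu; try by apply/andP; split; lra.
have h0 : mesh_size R 0 = 1 by rewrite /mesh_size expr0 invr1.
have h1 : mesh_size R 1 = 1 / 2 by rewrite /mesh_size expr1 div1r.
have n01 : node R 0 1 = 0 by rewrite /node h0 expr0; lra.
have n12 : node R 1 2 = 0 by rewrite /node h1 expr1; lra.
have n13 : node R 1 3 = 1 / 2 by rewrite /node h1 expr1; lra.
rewrite (@interp_cell 0 1 1) ?n01 ?h0 //; try (by apply/andP; split; lra).
(* The cells of the finer mesh in the unit square have their lower left corners
   at the nodes with indices 2 (coordinate 0) and 3 (coordinate 1/2).  In each of
   the two triangles of such a cell, all relus have a constant sign. *)
have cell i j : (i < 4)%N -> (j < 4)%N ->
    node R 1 i <= x <= node R 1 i + mesh_size R 1 ->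
    node R 1 j <= y <= node R 1 j + mesh_size R 1 -> _ :=
  fun hi hj => @interp_cell 1 i j x y hi hj.
rewrite h1 in cell.
case: (leP x (1 / 2)) => [?|/ltW ?]; case: (leP y (1 / 2)) => [?|/ltW ?].
- rewrite (cell 2%N 2%N) ?n12 //; try by apply/andP; split; lra.
  by rewrite /local_interp ?n01 ?n12; case: (leP (x + y) (1 / 2)) => ?;
    relu_signs; lra.
- rewrite (cell 2%N 3%N) ?n12 ?n13 //; try by apply/andP; split; lra.
  by rewrite /local_interp ?n01 ?n12 ?n13; case: (leP (x + y) 1) => ?;
    relu_signs; lra.
- rewrite (cell 3%N 2%N) ?n12 ?n13 //; try by apply/andP; split; lra.
  by rewrite /local_interp ?n01 ?n12 ?n13; case: (leP (x + y) 1) => ?;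
    relu_signs; lra.
- rewrite (cell 3%N 3%N) ?n13 //; try by apply/andP; split; lra.
  by rewrite /local_interp ?n01 ?n13; case: (leP (x + y) (3 / 2)) => ?;
    relu_signs; lra.
Qed.

End BasisFunctionRelu.

(** * The network *)

Section PhiNetwork.
Variable R : realType.

Definition mx_of (m n : nat) (a : seq (seq R)) : 'M[R]_(m, n) :=
  \matrix_(i, j) (nth [::] a i)`_j.

Definition cV_of (n : nat) (b : seq R) : 'cV[R]_n := \col_i b`_i.

(** One neuron for each kink of the sawtooths in [x] and in [y]. *)
Definition phi_first : 'M[R]_(6, 2) * 'cV[R]_6 :=
  (mx_of 6 2 [:: [:: 1; 0]; [:: 1; 0]; [:: 1; 0];
                 [:: 0; 1]; [:: 0; 1]; [:: 0; 1]],
   cV_of 6 [:: 0; - (1 / 2); - 1; 0; - (1 / 2); - 1]).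

(** Row 0 is the sum of the sawtooths in [x] and in [y]; rows 1 to 4 are
    [S], [S - 1/2], [S - 1] and [S - 3/2] with [S = relu1 x + relu1 y].  The
    missing entries for row 5 default to 0, so that neuron is idle. *)
Definition phi_mid : 'M[R]_(6, 6) * 'cV[R]_6 :=
  let S := [:: 1; 0; - 1; 1; 0; - 1] in
  (mx_of 6 6 [:: [:: 2; - 4; 2; 2; - 4; 2]; S; S; S; S],
   cV_of 6 [:: 0; 0; - (1 / 2); - 1; - (3 / 2)]).

Definition phi_last : 'M[R]_(1, 6) * 'cV[R]_1 :=
  (mx_of 1 6 [:: [:: 1 / 2; - 1; 2; - 2; 2]], 0).

Lemma phi_network (v : 'cV[R]_2) :
  network phi_first [:: phi_mid] phi_last v = phi (v 0 0) (v 1 0).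
Proof.
rewrite phi_g2; set x : R := v 0 0; set y : R := v 1 0.
have /andP[X0 X1] := relu1_itv x; have /andP[Y0 Y1] := relu1_itv y.
have saw_ge0 (z : R) : 0 <= z <= 1 -> 0 <= g2 (z / 2).
  move=> /andP[? ?]; rewrite g2_half_relu; last by apply/andP; split; lra.
  by case: (leP z (1 / 2)) => ?; relu_signs; lra.
have sx0 := saw_ge0 _ (relu1_itv x); have sy0 := saw_ge0 _ (relu1_itv y).
rewrite [X in _ - X]g2_half_relu; last by apply/andP; split; lra.
pose z1 := cV_of 6 [:: relu x; relu (x - 1 / 2); relu (x - 1);
                       relu y; relu (y - 1 / 2); relu (y - 1)].
have E1 : map_mx (@relu R) (affine phi_first v) = z1.
  apply/matrixP => i j; rewrite ord1 /affine !mxE !big_ord_recl big_ord0 !mxE.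
  have -> : v ord0 0 = x by [].
  have -> : v (lift ord0 ord0) 0 = y by congr (v _ _); apply: val_inj.
  case: i => -[|[|[|[|[|[|//]]]]]] ? /=; congr relu; ring.
pose S := relu1 x + relu1 y.
pose z2 := cV_of 6 [:: g2 (relu1 x / 2) + g2 (relu1 y / 2); S;
                       relu (S - 1 / 2); relu (S - 1); relu (S - 3 / 2); 0].
have E2 : map_mx (@relu R) (affine phi_mid z1) = z2.
  apply/matrixP => i j; rewrite ord1 /affine !mxE !big_ord_recl big_ord0 !mxE /=.
  case: i => -[|[|[|[|[|[|//]]]]]] ? /=.
  (* The first two entries of [z2] are nonnegative, so they equal their relu. *)
  - rewrite -[RHS]relu_ge0; last exact: addr_ge0.
    by rewrite !g2_relu1; congr relu; ring.
  - rewrite -[RHS]relu_ge0; last exact: addr_ge0.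
    by rewrite /S /relu1; congr relu; ring.
  - by rewrite /S /relu1; congr relu; ring.
  - by rewrite /S /relu1; congr relu; ring.
  - by rewrite /S /relu1; congr relu; ring.
  - by rewrite relu_ge0; lra.
rewrite /network /= E1 E2 /affine !mxE !big_ord_recl big_ord0 !mxE /=.
by rewrite !g2_relu1 -/S; field.
Qed.

End PhiNetwork.

Theorem lemma5p1 (R : realType) :
  @NN R 2 2 15 (fun v : 'cV[R]_2 => phi (v 0 0) (v 1 0)) /\
  forall x y : R,
    phi x y = 1 / 2 * (g2 (relu1 x / 2) + g2 (relu1 y / 2)
                       - g2 ((relu1 x + relu1 y) / 2)).
Proof.
split; last exact: phi_g2.
apply: (@NN_widen R 2 2 6) => //.
exists (phi_first R), [:: phi_mid R], (phi_last R).
by split=> // v; rewrite phi_network.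
Qed.
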